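(* The maps $P_L$ and $P_I$ are degree 1 maps from $\mathbb{T}^2$ to $P^1(\mathbb{C})$.
   Context: $\mathbb{T}^2$ is the 2-torus with points $(\exp(2\pi i\theta),\exp(2\pi i\varphi))$, $\theta,\varphi\in[0,1]$. $Proj_1(M_2(\mathbb{C}))$ is the space of rank 1 (orthogonal) projections in $M_2(\mathbb{C})$; it is canonically homeomorphic to the complex projective line $P^1(\mathbb{C})$ (a projection corresponds to its range), itself non-canonically homeomorphic to the 2-sphere $S^2$. A rank 1 projection in $M_2(C(\mathbb{T}^2))$ is viewed as a continuous map $\mathbb{T}^2\to P^1(\mathbb{C})$. Definition of $P_L$ (Loring's projection): let $a$ be a continuous, 1-periodic function with values in $[0,1]$, decreasing from 1 to 0 on $[0,1/2]$ and increasing from 0 to 1 on $[1/2,1]$. Put $b(\theta)=\sqrt{a(\theta)-a(\theta)^2}$ for $\theta\in[0,1/2]$ and $b(\theta)=0$ for $\theta\in[1/2,1]$; put $\beta(\theta)=0$ for $\theta\in[0,1/2]$ and $\beta(\theta)=\sqrt{a(\theta)-a(\theta)^2}$ for $\theta\in[1/2,1]$. Then $$P_L(\theta,\varphi)=\begin{pmatrix}a(\theta) & b(\theta)+\beta(\theta)\exp(2\pi i\varphi)\\ b(\theta)+\beta(\theta)\exp(-2\pi i\varphi) & 1-a(\theta)\end{pmatrix}.$$ Definition of $P_I$: $P_I(\theta,\varphi)=\frac14\begin{pmatrix}4-t & w\\ \overline{w} & t\end{pmatrix}$ with $t=(1-\cos(2\pi\theta))(1-\cos(2\pi\varphi))$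 and $w=\sin(2\pi\theta)(1-\cos(2\pi\varphi))+i\sin(2\pi\varphi)\sqrt{2(1-\cos(2\pi\theta))}$. Both $P_L$ and $P_I$ are rank 1 projections in $M_2(C(\mathbb{T}^2))$. *)

(* Defs.v *)
From HB Require Import structures.
From mathcomp Require Import all_boot all_order all_algebra.
From mathcomp Require Import all_classical all_reals all_analysis.
From mathcomp.real_closed Require Import complex.

Set Implicit Arguments.
Unset Strict Implicit.
Unset Printing Implicit Defensive.

Import Order.TTheory GRing.Theory Num.Theory numFieldNormedType.Exports.

Local Open Scope classical_set_scope.
Local Open Scope ring_scope.
Local Open Scope complex_scope.
Local Open Scope sesquilinear_scope.

(* The usual metric topology on the complex numbers; it is inherited by
   products and by matrix spaces. *)
HB.instance Definition _ (R : realType) := NormedModule.copy R[i] (R[i]^o).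

Section Spaces.
Variable R : realType.

(* exp(2 pi i t) *)
Definition cis (t : R) : R[i] := cos (2 * pi * t) +i* sin (2 * pi * t).

Definition torus : set (R[i] * R[i]) :=
  [set p | `|p.1| = 1 /\ `|p.2| = 1].

Definition torus_pt (x : R * R) : R[i] * R[i] := (cis x.1, cis x.2).

(* The rank 1 orthogonal projections of M_2(C), playing the role of P^1(C):
   a projection stands for its range. *)
Definition Proj1 : set 'M[R[i]]_2 :=
  [set P | [/\ P *m P = P, P ^t* = P & \rank P = 1%N]].

(* Maps from the torus are total functions on C * C whose values outside of
   the torus are irrelevant. *)
Definition torus_map (f : R[i] * R[i] -> 'M[R[i]]_2) : Prop :=
  {within torus, continuous f} /\ (forall p, torus p -> Proj1 (f p)).

Definition torus_homotopic (f g : R[i] * R[i] -> 'M[R[i]]_2) : Prop :=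
  exists H : R * (R[i] * R[i]) -> 'M[R[i]]_2,
    [/\ {within `[0, 1] `*` torus, continuous H},
        (forall s p, 0 <= s <= 1 -> torus p -> Proj1 (H (s, p))),
        (forall p, torus p -> H (0, p) = f p) &
        (forall p, torus p -> H (1, p) = g p)].

(* [F], given in the coordinates (theta, phi) of [0, 1]^2, descends to the
   continuous map [f] from the torus to P^1(C). *)
Definition induces (F : R * R -> 'M[R[i]]_2) (f : R[i] * R[i] -> 'M[R[i]]_2) :
    Prop :=
  torus_map f /\
  (forall x, 0 <= x.1 <= 1 -> 0 <= x.2 <= 1 -> f (torus_pt x) = F x).

End Spaces.

(* Degree of a continuous map T^2 -> P^1(C), as in differential topology:
   f is replaced by a homotopic C^1 map g, and the points of the fibre of g
   over a regular value y are counted with the sign of the Jacobian.  The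
   result depends neither on g nor on y.
   Orientations: (theta, phi) are positive coordinates on T^2, and P^1(C) has
   its orientation as a complex manifold. *)
Section Degree.
Variable R : realType.

Definition C1 (u : R * R -> R) : Prop :=
  [/\ (forall x, derivable u x (1, 0)), (forall x, derivable u x (0, 1)),
      continuous (fun x => 'D_(1, 0) u x) &
      continuous (fun x => 'D_(0, 1) u x)].

Definition torus_C1 (g : R[i] * R[i] -> 'M[R[i]]_2) : Prop :=
  forall i j, C1 (fun x => complex.Re (g (torus_pt x) i j)) /\
              C1 (fun x => complex.Im (g (torus_pt x) i j)).

(* The two affine coordinates of P^1(C), defined where P k k != 0: the k-th
   column of P spans its range, which is the line [1 : P10 / P00] for k = 0
   and [P01 / P11 : 1] for k = 1.  The transition map z |-> 1 / z is
   holomorphic, so both define the same orientation. *)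
Definition chart (k : 'I_2) (P : 'M[R[i]]_2) : R[i] := P (rev_ord k) k / P k k.

Definition jacobian (k : 'I_2) (g : R[i] * R[i] -> 'M[R[i]]_2) (x : R * R) : R :=
  let u x := complex.Re (chart k (g (torus_pt x))) in
  let v x := complex.Im (chart k (g (torus_pt x))) in
  'D_(1, 0) u x * 'D_(0, 1) v x - 'D_(0, 1) u x * 'D_(1, 0) v x.

(* [0, 1[^2 parametrizes the torus bijectively. *)
Definition fibre (g : R[i] * R[i] -> 'M[R[i]]_2) (y : 'M[R[i]]_2) :
    set (R * R) :=
  [set x | [/\ 0 <= x.1 < 1, 0 <= x.2 < 1 & g (torus_pt x) = y]].

Definition has_degree (f : R[i] * R[i] -> 'M[R[i]]_2) (d : int) : Prop :=
  exists g : R[i] * R[i] -> 'M[R[i]]_2,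
    [/\ torus_map g, torus_C1 g, torus_homotopic f g &
        exists (y : 'M[R[i]]_2) (k : 'I_2),
          [/\ Proj1 y, y k k != 0, finite_set (fibre g y),
              (forall x, fibre g y x -> jacobian k g x != 0) &
              \sum_(x \in fibre g y) sgz (jacobian k g x) = d]].

End Degree.

Section Projections.
Variable R : realType.

Definition mx2 (a b c d : R[i]) : 'M[R[i]]_2 :=
  \matrix_(i, j) if i == 0 then (if j == 0 then a else b)
                 else (if j == 0 then c else d).

Definition loring_function (a : R -> R) : Prop :=
  [/\ continuous a, (forall t, a (t + 1) = a t), (forall t, 0 <= a t <= 1),
      [/\ a 0 = 1, a (1 / 2) = 0 & a 1 = 1] &
      (forall s t, 0 <= s -> s <= t -> t <= 1 / 2 -> a t <= a s) /\
      (forall s t, 1 / 2 <= s -> s <= t -> t <= 1 -> a s <= a t)].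

Definition loring_b (a : R -> R) (t : R) : R :=
  if t <= 1 / 2 then Num.sqrt (a t - a t ^+ 2) else 0.

Definition loring_beta (a : R -> R) (t : R) : R :=
  if t <= 1 / 2 then 0 else Num.sqrt (a t - a t ^+ 2).

Definition PL (a : R -> R) (x : R * R) : 'M[R[i]]_2 :=
  let b := loring_b a x.1 in
  let beta := loring_beta a x.1 in
  mx2 (a x.1)%:C (b%:C + beta%:C * cis x.2)
      (b%:C + beta%:C * cis (- x.2)) (1 - a x.1)%:C.

Definition PI (x : R * R) : 'M[R[i]]_2 :=
  let: (theta, phi) := (2 * pi * x.1, 2 * pi * x.2) in
  let t := (1 - cos theta) * (1 - cos phi) in
  let w := (sin theta * (1 - cos phi))
             +i* (sin phi * Num.sqrt (2 * (1 - cos theta))) in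
  (1 / 4) *: mx2 (4 - t)%:C w w^* t%:C.

End Projections.

(* Main.v *)
Require Import Defs.
From mathcomp Require Import all_boot all_order all_algebra.
From mathcomp Require Import all_classical all_reals all_analysis.
From mathcomp.real_closed Require Import complex.
From mathcomp Require Import ring lra.

Set Implicit Arguments.
Unset Strict Implicit.
Unset Printing Implicit Defensive.

Import Order.TTheory GRing.Theory Num.Theory numFieldNormedType.Exports.

Local Open Scope classical_set_scope.
Local Open Scope ring_scope.
Local Open Scope complex_scope.
Local Open Scope sesquilinear_scope.

(** A rank 1 projection of M_2(C) has diagonal entries (1 + z) / 2, (1 - z) / 2
and off-diagonal entries (x + i y) / 2, (x - i y) / 2 for a unique unit vector
n = (x, y, z) of R^3, its Bloch vector, and a nonzero vector N of R^3 defines a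
projection through N / |N|.  So maps to P^1(C) may be handled as vector fields
with values in R^3 without zeros, and two of them are homotopic as soon as the
segment from n(p) to N(p) avoids the origin for every p ([homotopic_ref]).

This suggests replacing each of the given maps, which are not C^1 in general,
by a vector field N whose components are trigonometric polynomials.  With
c1 + i s1 = exp(2 pi i theta) and c2 + i s2 = exp(2 pi i phi), take

  N = (1 + s1 + (1 - s1) c2, (1 - s1) s2, c1)               for P_L,
  N = (s1 (1 - c2), s2 (1 - c1), 2 - (1 - c1) (1 - c2))     for P_I.

The first one mimics the vector 2 b + 2 beta exp(2 pi i phi) with the smooth
weights 1 + s1 and 1 - s1, of which the first is the larger one exactly when
0 < theta < 1/2.  The second one is twice the Bloch vector of P_I, except that
sqrt(2 (1 - c1)), which has a kink at theta = 0, has become 1 - c1, which is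
positive at the same points.

In both cases N points to the south pole (0, 0, -1) only at theta = phi = 1/2,
so the fibre over that pole is a single point.  There the coordinate
P01 / P11 of P^1(C) is (x + i y) / (|N| - z), whose Jacobian is a positive
multiple of that of (x, y) because x and y vanish; and the latter is
positive.  Hence the degree is 1 ([degree1_criterion]).

That the given formulas define continuous maps on the torus comes from the
fact that a continuous function whose values agree on opposite edges of the
unit square factors, on the square, through the torus ([ex_induces]): the image under
[torus_pt] of a closed subset of the square is compact, hence closed. *)

(** * Continuity of maps involving complex numbers and matrices *)

Section Topology.
Variable R : realType.

Lemma cvg_mxP (U : topologicalType) (T : Type) (F : set_system T) (m n : nat)
    (f : T -> 'M[U]_(m, n)) (l : 'M[U]_(m, n)) : Filter F ->
  (forall i j, f t i j @[t --> F] --> l i j) -> f t @[t --> F] --> l.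
Proof.
move=> FF fl A [P lP PA].
apply: (@filterS _ F _ (fun t => forall i j, P i j (f t i j))) => [t|].
  exact: PA.
apply: filter_forall => i; apply: filter_forall => j; exact: fl (lP i j).
Qed.

Lemma cvg_complex (T : Type) (F : set_system T) (u v : T -> R) (a b : R) :
  Filter F -> u t @[t --> F] --> a -> v t @[t --> F] --> b ->
  (u t +i* v t) @[t --> F] --> (a +i* b : R[i]).
Proof.
move=> FF ua vb; apply/cvgrPdist_lt => e; rewrite ltcE => /andP[/eqP /= e0 Re0].
have e2 : 0 < complex.Re e / 2 by rewrite divr_gt0.
near=> t.
rewrite normc_def ltcE /= e0 eqxx /=.
have h1 : `|a - u t| < complex.Re e / 2 by near: t; move/cvgrPdist_lt: ua; exact.
have h2 : `|b - v t| < complex.Re e / 2 by near: t; move/cvgrPdist_lt: vb; exact.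
rewrite -(ltr_pXn2r (n := 2)) ?nnegrE ?sqrtr_ge0 ?ltW //.
rewrite sqr_sqrtr ?addr_ge0 ?sqr_ge0 //.
rewrite -[(a - _) ^+ 2]real_normK ?num_real //.
rewrite -[(b - _) ^+ 2]real_normK ?num_real //.
have := normr_ge0 (a - u t); have := normr_ge0 (b - v t); nra.
Unshelve. all: by end_near. Qed.

Lemma Re_continuous : continuous (@complex.Re R).
Proof.
move=> z; apply/(@cvgrPdist_lt _ _ _ _ (nbhs_filter (z : R[i]))) => e e0.
have zw : \forall w \near (z : R[i]), `|z - w| < e%:C.
  by have /cvgrPdist_lt := @cvg_id _ (nbhs (z : R[i])); apply; rewrite ltcR.
apply: filterS zw => w h; rewrite -ltcR; apply: le_lt_trans h.
rewrite (_ : complex.Re z - complex.Re w = complex.Re (z - w)).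
  exact: normc_ge_Re.
by case: z; case: w.
Qed.

Lemma Im_continuous : continuous (@complex.Im R).
Proof.
move=> z; apply/(@cvgrPdist_lt _ _ _ _ (nbhs_filter (z : R[i]))) => e e0.
have zw : \forall w \near (z : R[i]), `|z - w| < e%:C.
  by have /cvgrPdist_lt := @cvg_id _ (nbhs (z : R[i])); apply; rewrite ltcR.
apply: filterS zw => w h; rewrite -ltcR; apply: le_lt_trans h.
have -> : `|z - w| = `|(z - w) * 'i|.
  by rewrite normrM [`|'i|]normc_def /= expr0n expr1n add0r sqrtr1 mulr1.
rewrite (_ : complex.Im z - complex.Im w = - complex.Re ((z - w) * 'i)).
  by rewrite normrN; exact: normc_ge_Re.
by case: z; case: w => a b c d /=; ring.
Qed.

Lemma cis_norm (t : R) : `|cis t| = 1.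
Proof. by rewrite normc_def /= cos2Dsin2 sqrtr1. Qed.

Lemma torus_pt_torus (x : R * R) : torus (torus_pt x).
Proof. by split; exact: cis_norm. Qed.

Lemma cis_continuous : continuous (@cis R).
Proof.
move=> t; apply: cvg_complex.
  apply: (@continuous_comp _ _ _ (fun t : R => 2 * pi * t) cos);
    last exact: continuous_cos.
  by apply: cvgM; [exact: cvg_cst | exact: cvg_id].
apply: (@continuous_comp _ _ _ (fun t : R => 2 * pi * t) sin);
  last exact: continuous_sin.
by apply: cvgM; [exact: cvg_cst | exact: cvg_id].
Qed.

Lemma torus_pt_continuous : continuous (@torus_pt R).
Proof.
move=> x; apply: (@cvg_pair _ _ _ _ (nbhs (cis x.1)) (nbhs (cis x.2))).
  exact: (@cvg_comp _ _ _ fst (@cis R) _ (nbhs x.1) _ cvg_fst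
    (@cis_continuous _)).
exact: (@cvg_comp _ _ _ snd (@cis R) _ (nbhs x.2) _ cvg_snd
  (@cis_continuous _)).
Qed.

End Topology.

(** * The torus as a quotient of the unit square *)

Section Quotient.
Variable R : realType.

Definition unit_square : set (R * R) := `[0, 1] `*` `[0, 1].

Lemma unit_squareP (x : R * R) :
  unit_square x <-> (0 <= x.1 <= 1) /\ (0 <= x.2 <= 1).
Proof. by rewrite /unit_square /= !in_itv /=. Qed.

Lemma cis0 : cis (0 : R) = 1.
Proof. by rewrite /cis mulr0 cos0 sin0. Qed.

Lemma cis1 : cis (1 : R) = 1.
Proof. by rewrite /cis mulr1 mulr_natl cos2pi sin2pi. Qed.

Lemma cis_half : cis (1 / 2 : R) = -1.
Proof.
rewrite /cis (_ : 2 * pi * (1 / 2) = pi :> R); last by field.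
by rewrite cospi sinpi; apply/eqP; rewrite eq_complex /= oppr0 !eqxx.
Qed.

Lemma cis_surj (z : R[i]) : `|z| = 1 -> exists2 t : R, 0 <= t <= 1 & cis t = z.
Proof.
case: z => a b; rewrite normc_def /= => /(congr1 (@complex.Re R)) /= ab1.
have {}ab1 : a ^+ 2 + b ^+ 2 = 1.
  by rewrite -[LHS]sqr_sqrtr ?addr_ge0 ?sqr_ge0 // ab1 expr1n.
have a1 : -1 <= a <= 1 by have := sqr_ge0 b; nra.
have pi0 := pi_gt0 R.
have [/andP[ac0 acpi] cosa] := acos_def a1.
have sina : sin (acos a) = `|b|.
  by rewrite sin_acos // -ab1 addrC addKr sqrtr_sqr.
have tpi : 2 * pi * (acos a / (2 * pi)) = acos a.
  by rewrite mulrC divfK // mulf_neq0 ?pnatr_eq0 // gt_eqF.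
have t0 : 0 <= acos a / (2 * pi) by rewrite divr_ge0 // mulr_ge0 // ltW.
have t1 : acos a / (2 * pi) <= 1 by rewrite ler_pdivrMr ?mulr_gt0 //; lra.
have [b0|b0] := leP 0 b.
  exists (acos a / (2 * pi)); first by rewrite t0.
  by rewrite /cis tpi cosa sina ger0_norm.
exists (1 - acos a / (2 * pi)); first lra.
rewrite /cis mulrBr mulr1 tpi mulr_natl addrC cosD2pi sinD2pi cosN sinN cosa sina.
by rewrite ltr0_norm // opprK.
Qed.

Lemma cis_inj (s t : R) : 0 <= s <= 1 -> 0 <= t <= 1 -> cis s = cis t ->
  [\/ s = t, s = 0 /\ t = 1 | s = 1 /\ t = 0].
Proof.
move=> s01 t01; wlog ts : s t s01 t01 / t <= s.
  move=> W st; have [ts|/ltW ts] := leP t s; first exact: W.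
  by have [->|[-> ->]|[-> ->]] := W t s t01 s01 ts (esym st);
    [exact: Or31|exact: Or33|exact: Or32].
case=> cst sst; have pi0 := pi_gt0 R.
have cosd : cos (2 * pi * (s - t)) = 1.
  by rewrite mulrBr cosB cst sst -!expr2 cos2Dsin2.
have cos_1 (u : R) : 0 <= u <= 1 / 2 -> cos (2 * pi * u) = 1 -> u = 0.
  move=> /andP[u0 u1] cu; have : 2 * pi * u = 0.
    apply: cos_inj; rewrite ?cos0 // in_itv /=.
      by rewrite !mulr_ge0 ?(ltW pi0) //=; nra.
    by rewrite lexx ltW.
  by move/eqP; rewrite !mulf_eq0 pnatr_eq0 (gt_eqF pi0) => /eqP.
have [d|d] := leP (s - t) (1 / 2).
  by apply: Or31; have : s - t = 0; [apply: cos_1 => //; lra | lra].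
apply: Or33; have : 1 - (s - t) = 0; last lra.
apply: cos_1; first lra.
by rewrite mulrBr mulr1 [X in cos (X - _)]mulr_natl addrC cosD2pi cosN.
Qed.

Lemma torus_pt_surj (p : R[i] * R[i]) : torus p ->
  exists2 x, unit_square x & torus_pt x = p.
Proof.
case: p => p1 p2 [/= /cis_surj[s s01 <-] /cis_surj[t t01 <-]].
by exists (s, t) => //; apply/unit_squareP.
Qed.

(** The map is continuous because the preimage of a closed set is the image under
[torus_pt] of a closed subset of the square, which is compact. *)
Lemma ex_induces (F : R * R -> 'M[R[i]]_2) : continuous F ->
  (forall x, unit_square x -> Proj1 (F x)) ->
  (forall t, 0 <= t <= 1 -> F (0, t) = F (1, t)) ->
  (forall t, 0 <= t <= 1 -> F (t, 0) = F (t, 1)) ->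
  exists f, induces F f.
Proof.
move=> Fc FP F1 F2.
have F_torus x y : unit_square x -> unit_square y ->
    torus_pt x = torus_pt y -> F x = F y.
  move=> /unit_squareP[]; case: x => x1 x2 /= hx1 hx2.
  move=> /unit_squareP[]; case: y => y1 y2 /= hy1 hy2 [e1 e2 e3 e4].
  have /(cis_inj hx1 hy1) C1 : cis x1 = cis y1 by rewrite /cis e1 e2.
  have /(cis_inj hx2 hy2) C2 : cis x2 = cis y2 by rewrite /cis e3 e4.
  transitivity (F (y1, x2)).
    by case: C1 => [->|[-> ->]|[-> ->]] //; rewrite F1.
  by case: C2 => [->|[-> ->]|[-> ->]] //; rewrite F2.
pose pre p := xget 0 [set x | unit_square x /\ torus_pt x = p].
have preP p : torus p -> unit_square (pre p) /\ torus_pt (pre p) = p.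
  move=> /torus_pt_surj[x sx xp].
  by rewrite /pre; case: xgetP => [y _ //|/(_ x)[]].
have fE x : unit_square x -> F (pre (torus_pt x)) = F x.
  move=> sx; have [] := preP (torus_pt x); first exact: torus_pt_torus.
  by move=> sp /F_torus; apply.
exists (F \o pre); split; last by move=> x x1 x2; apply: fE; apply/unit_squareP.
split; last by move=> p /preP[sp _]; exact: FP.
apply/continuous_closedP => A cA; apply/closed_subspaceP.
exists (@torus_pt R @` (unit_square `&` F @^-1` A)).
  apply: compact_closed; first exact: norm_hausdorff.
  apply: continuous_compact.
    by apply: continuous_subspaceT; exact: torus_pt_continuous.
  apply: compact_closedI.
    by apply: compact_setX; exact: segment_compact.
  by move/continuous_closedP : Fc; apply.
rewrite predeqE => p; split => [[[x [sx Ax] <-] tp]|[Ap tp]]; split => //.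
  by move: Ax; rewrite /= -(fE _ sx).
by have [sp pp] := preP p tp; exists (pre p).
Qed.

End Quotient.

(** * Projections and the unit sphere *)

Section Bloch.
Variable R : realType.

(** The matrix (1 + x sigma_1 - y sigma_2 + z sigma_3) / 2; the sign of sigma_2
is chosen so that the upper right entry is (x + i y) / 2. *)
Definition bloch (x y z : R) : 'M[R[i]]_2 :=
  mx2 ((1 + z) / 2)%:C ((x / 2) +i* (y / 2))
      ((x / 2) -i* (y / 2)) ((1 - z) / 2)%:C.

Definition bloch_x (P : 'M[R[i]]_2) : R := 2 * complex.Re (P 0 1).
Definition bloch_y (P : 'M[R[i]]_2) : R := 2 * complex.Im (P 0 1).
Definition bloch_z (P : 'M[R[i]]_2) : R := complex.Re (P 0 0) - complex.Re (P 1 1).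

Lemma mx2P (A B : 'M[R[i]]_2) :
  A 0 0 = B 0 0 -> A 0 1 = B 0 1 -> A 1 0 = B 1 0 -> A 1 1 = B 1 1 -> A = B.
Proof.
move=> e00 e01 e10 e11; apply/matrixP => i j.
have ord2 (k : 'I_2) : k = 0 \/ k = 1.
  by case: k => [[|[|k]] Hk] //; [left|right]; exact: val_inj.
by have [-> | ->] := ord2 i; have [-> | ->] := ord2 j.
Qed.

Lemma det_mx2 (A : 'M[R[i]]_2) : \det A = A 0 0 * A 1 1 - A 0 1 * A 1 0.
Proof.
rewrite (expand_det_row _ 0) !big_ord_recl big_ord0 /cofactor !det_mx11 !mxE /=.
rewrite addr0 expr0 mul1r expr1 mulN1r mulrN.
by congr (A _ _ * A _ _ - A _ _ * A _ _); exact: val_inj.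
Qed.

(** On the unit sphere the determinant vanishes while the trace is 1, so the
rank is 1. *)
Lemma bloch_Proj1 x y z : x ^+ 2 + y ^+ 2 + z ^+ 2 = 1 -> Proj1 (bloch x y z).
Proof.
move=> xyz; have detP : \det (bloch x y z) = 0.
  rewrite det_mx2 !mxE /=; apply/eqP; rewrite eq_complex /=.
  by apply/andP; split; apply/eqP; [nra | lra].
split.
- apply: mx2P; rewrite !mxE !big_ord_recl big_ord0 !mxE /=;
  apply/eqP; rewrite eq_complex /=;
  apply/andP; split; apply/eqP; nra.
- by apply: mx2P; rewrite !mxE /=; apply/eqP; rewrite eq_complex /=;
  apply/andP; split; apply/eqP; lra.
- apply/eqP; rewrite eqn_leq; apply/andP; split.
    rewrite -ltnS ltn_neqAle rank_leq_row andbT; apply/negP => rk.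
    have : bloch x y z \in unitmx by rewrite -row_free_unit.
    by rewrite unitmxE detP unitr0.
  rewrite lt0n mxrank_eq0; apply/negP => /eqP P0.
  have := congr1 (fun P : 'M[R[i]]_2 => complex.Re (P 0 0 + P 1 1)) P0.
  by rewrite !mxE /= => ?; lra.
Qed.

(** Idempotency and a zero determinant give P (tr P - 1) = 0 entrywise, so that
the trace is 1; the three remaining real parameters are the Bloch vector, and
the vanishing determinant says that it has norm 1. *)
Lemma Proj1_bloch (P : 'M[R[i]]_2) : Proj1 P ->
  P = bloch (bloch_x P) (bloch_y P) (bloch_z P) /\
  bloch_x P ^+ 2 + bloch_y P ^+ 2 + bloch_z P ^+ 2 = 1.
Proof.
case=> PP Ph Pr.
have detP : \det P = 0.
  apply/eqP; apply: contraT; rewrite -unitfE -unitmxE => /mxrank_unit.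
  by rewrite Pr.
have Pn0 : P != 0 by rewrite -mxrank_eq0 Pr.
have H i j : P i j = (P j i)^*%C by rewrite -{1}Ph !mxE.
have M i j : P i j = P i 0 * P 0 j + P i 1 * P 1 j.
  rewrite -{1}PP !mxE !big_ord_recl big_ord0 addr0.
  by congr (_ * P _ _ + P _ _ * P _ _); exact: val_inj.
rewrite det_mx2 in detP.
move: (M 0 0) (M 0 1) (M 1 1) (H 0 0) (H 1 1) (H 1 0) detP.
rewrite /bloch_x /bloch_y /bloch_z {M H PP Ph Pr}.
case E00 : (P 0 0) => [a a']; case E11 : (P 1 1) => [d d'].
case E01 : (P 0 1) => [b b']; case E10 : (P 1 0) => [c c'] /=.
move=> [m1 _] [m2 m3] [m4 _] [h1] [h2] [cE c'E] [p1 _]; subst c c'.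
have {h1} a'0 : a' = 0 by lra.
have {h2} d'0 : d' = 0 by lra.
subst a' d'.
have tr1 : a + d = 1.
  apply/eqP; apply: contraT; rewrite -subr_eq0 => tr.
  have kill (u : R) : u * (a + d - 1) = 0 -> u = 0.
    by move/eqP; rewrite mulf_eq0 (negbTE tr) orbF => /eqP.
  have a0 : a = 0 by apply: kill; lra.
  have b0 : b = 0 by apply: kill; lra.
  have b'0 : b' = 0 by apply: kill; lra.
  have d0 : d = 0 by apply: kill; lra.
  case/eqP: Pn0; apply: mx2P;
    rewrite !mxE ?E00 ?E01 ?E11 ?E10 ?a0 ?b0 ?b'0 ?d0 ?oppr0 //.
split; last by rewrite (_ : d = 1 - a); nra.
apply: mx2P; rewrite !mxE ?E00 ?E01 ?E10 ?E11 /=; apply/eqP; rewrite eq_complex /=;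
  apply/andP; split; apply/eqP; lra.
Qed.
End Bloch.

Section BlochRay.
Variable R : realType.

Definition bloch_ray (x y z : R) : 'M[R[i]]_2 :=
  let r := Num.sqrt (x ^+ 2 + y ^+ 2 + z ^+ 2) in bloch (x / r) (y / r) (z / r).

Lemma bloch_ray_Proj1 x y z : x ^+ 2 + y ^+ 2 + z ^+ 2 != 0 -> Proj1 (bloch_ray x y z).
Proof.
move=> n0; apply: bloch_Proj1; rewrite !expr_div_n sqr_sqrtr -?mulrDl ?divff //.
by rewrite !addr_ge0 ?sqr_ge0.
Qed.

Lemma bloch_ray_unit x y z : x ^+ 2 + y ^+ 2 + z ^+ 2 = 1 ->
  bloch_ray x y z = bloch x y z.
Proof. by rewrite /bloch_ray => ->; rewrite sqrtr1 !divr1. Qed.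

Section Cvg.
Variables (T : Type) (F : set_system T).
Hypothesis FF : Filter F.

Lemma cvg_mx2 (a b c d : T -> R[i]) (a0 b0 c0 d0 : R[i]) :
  a t @[t --> F] --> a0 -> b t @[t --> F] --> b0 ->
  c t @[t --> F] --> c0 -> d t @[t --> F] --> d0 ->
  mx2 (a t) (b t) (c t) (d t) @[t --> F] --> mx2 a0 b0 c0 d0.
Proof.
move=> fa fb fc fd; apply: cvg_mxP => i j.
have -> : (fun t => mx2 (a t) (b t) (c t) (d t) i j) = fun t =>
  if i == 0 then if j == 0 then a t else b t else if j == 0 then c t else d t.
  by apply/funext => t; rewrite mxE.
rewrite mxE; case: (i == 0); case: (j == 0).
- exact: fa.
- exact: fb.
- exact: fc.
- exact: fd.
Qed.

Lemma cvg_bloch (x y z : T -> R) (x0 y0 z0 : R) :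
  x t @[t --> F] --> x0 -> y t @[t --> F] --> y0 -> z t @[t --> F] --> z0 ->
  bloch (x t) (y t) (z t) @[t --> F] --> bloch x0 y0 z0.
Proof.
move=> fx fy fz.
have half u (u0 : R) : u t @[t --> F] --> u0 -> u t / 2 @[t --> F] --> u0 / 2.
  by move=> fu; apply: cvgM => //; exact: cvg_cst.
apply: cvg_mx2; apply: cvg_complex; try exact: cvg_cst; try exact: half.
- by apply: half; apply: cvgD => //; exact: cvg_cst.
- by apply: cvgN; exact: half.
- by apply: half; apply: cvgB => //; exact: cvg_cst.
Qed.

Lemma cvg_bloch_ray (x y z : T -> R) (x0 y0 z0 : R) :
  x0 ^+ 2 + y0 ^+ 2 + z0 ^+ 2 != 0 ->
  x t @[t --> F] --> x0 -> y t @[t --> F] --> y0 -> z t @[t --> F] --> z0 ->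
  bloch_ray (x t) (y t) (z t) @[t --> F] --> bloch_ray x0 y0 z0.
Proof.
move=> n0 fx fy fz.
have r0 : Num.sqrt (x0 ^+ 2 + y0 ^+ 2 + z0 ^+ 2) != 0.
  by rewrite sqrtr_eq0 -ltNge lt_def n0 !addr_ge0 ?sqr_ge0.
have fr : (Num.sqrt (x t ^+ 2 + y t ^+ 2 + z t ^+ 2))^-1 @[t --> F] -->
          (Num.sqrt (x0 ^+ 2 + y0 ^+ 2 + z0 ^+ 2))^-1.
  apply: cvgV => //; apply: continuous_cvg; first exact: sqrt_continuous.
  by apply: cvgD; [apply: cvgD|]; apply: cvgM.
by apply: cvg_bloch; apply: cvgM.
Qed.

End Cvg.

Lemma bloch_coord_continuous :
  [/\ continuous (@bloch_x R), continuous (@bloch_y R) & continuous (@bloch_z R)].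
Proof.
have RE i j : continuous (fun P : 'M[R[i]]_2 => complex.Re (P i j)).
  by move=> P; apply: (continuous_comp (f := fun P : 'M[R[i]]_2 => P i j));
    [exact: coord_continuous | exact: Re_continuous].
have IE i j : continuous (fun P : 'M[R[i]]_2 => complex.Im (P i j)).
  by move=> P; apply: (continuous_comp (f := fun P : 'M[R[i]]_2 => P i j));
    [exact: coord_continuous | exact: Im_continuous].
split=> P.
- exact: (cvgM (cvg_cst (2 : R)) (RE 0 1 P)).
- exact: (cvgM (cvg_cst (2 : R)) (IE 0 1 P)).
- exact: (cvgB (RE 0 0 P) (RE 1 1 P)).
Qed.

End BlochRay.

(** * Functions of class C^1 on the plane *)

Section Smooth.
Variable R : realType.

(** The product rule involves the factors themselves, so the continuity of the
partial derivatives is inherited by products only along with that of the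
functions. *)
Definition smooth (u : R * R -> R) := continuous u /\ C1 u.

(** A directional derivative is an ordinary one along a line, which reduces the
chain rule to the one for real functions. *)
Lemma derive_line (V : normedModType R) (u : V -> R) (x v : V) :
  'D_v u x = 'D_1 (fun h : R => u (h *: v + x)) 0.
Proof.
rewrite /derive; set g1 := fun h => h^-1 *: _; set g2 := fun h => h^-1 *: _.
suff -> : g1 = g2 by [].
by apply/funext => h; rewrite /g1 /g2 /= addr0 scale0r add0r [_%:A]mulr1.
Qed.

Lemma is_derive_comp (V : normedModType R) (psi : R -> R) (u : V -> R)
    (x v : V) (d : R) :
  is_derive (u x) 1 psi d -> derivable u x v ->
  is_derive x v (fun y => psi (u y)) (d * 'D_v u x).
Proof.
move=> dpsi du.
have [D E] : is_derive (0 : R) 1 (psi \o fun h => u (h *: v + x)) (d * 'D_v u x).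
  apply: is_derive1_comp; first by rewrite scale0r add0r.
  by apply: DeriveDef; [exact: (derivable1P u x v).1 | rewrite (derive_line u)].
split; first exact: (derivable1P (fun y => psi (u y)) x v).2 D.
by rewrite (derive_line (fun y => psi (u y))); exact: E.
Qed.

Lemma C1_smooth u (d : R * R -> R * R -> R) : continuous u ->
  (forall v : R * R, v = (1, 0) \/ v = (0, 1) ->
    (forall x : R * R, is_derive x v u (d v x)) /\ continuous (d v)) -> smooth u.
Proof.
move=> cu H; split=> //; have [d1 c1] := H (1, 0) (or_introl erefl).
have [d2 c2] := H (0, 1) (or_intror erefl); split.
- by move=> x; case: (d1 x).
- by move=> x; case: (d2 x).
- by rewrite (_ : (fun x => _) = d (1, 0)) //; apply/funext => x; case: (d1 x).
- by rewrite (_ : (fun x => _) = d (0, 1)) //; apply/funext => x; case: (d2 x).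
Qed.

Lemma smoothP u : smooth u -> forall v : R * R, v = (1, 0) \/ v = (0, 1) ->
  (forall x, derivable u x v) /\ continuous (fun x => 'D_v u x).
Proof.
move=> [_ [d1 d2 c1 c2]] v [->|->]; split.
- exact: d1.
- exact: c1.
- exact: d2.
- exact: c2.
Qed.

Lemma smooth_cst (c : R) : smooth (fun=> c).
Proof.
apply: (@C1_smooth _ (fun _ _ => 0)); first exact: cst_continuous.
by move=> v _; split=> [x|]; [exact: is_derive_cst | exact: cst_continuous].
Qed.

Lemma smoothD u w : smooth u -> smooth w -> smooth (fun x => u x + w x).
Proof.
move=> su sw; apply: (@C1_smooth _ (fun v x => 'D_v u x + 'D_v w x)).
  by move=> x; apply: cvgD; [exact: su.1|exact: sw.1].
move=> v hv; have [du cu] := smoothP su hv; have [dw cw] := smoothP sw hv.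
split=> x; first by apply: is_deriveD; exact/derivableP.
by apply: cvgD; [exact: cu|exact: cw].
Qed.

Lemma smoothM u w : smooth u -> smooth w -> smooth (fun x => u x * w x).
Proof.
move=> su sw; apply: (@C1_smooth _ (fun v x => u x * 'D_v w x + w x * 'D_v u x)).
  by move=> x; apply: cvgM; [exact: su.1|exact: sw.1].
move=> v hv; have [du cu] := smoothP su hv; have [dw cw] := smoothP sw hv.
split=> x; first by apply: is_deriveM; exact/derivableP.
by apply: cvgD; apply: cvgM; [exact: su.1|exact: cw|exact: sw.1|exact: cu].
Qed.

Lemma smoothB u w : smooth u -> smooth w -> smooth (fun x => u x - w x).
Proof.
move=> su sw; apply: smoothD => //.
rewrite (_ : (fun x => - w x) = fun x => -1 * w x); last first.
  by apply/funext => x; rewrite mulN1r.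
exact: smoothM (smooth_cst _) sw.
Qed.

Lemma smooth_rsqrt u : (forall x, 0 < u x) -> smooth u ->
  smooth (fun x => (Num.sqrt (u x))^-1).
Proof.
move=> u0 su.
have s0 x : Num.sqrt (u x) != 0 by rewrite sqrtr_eq0 -ltNge.
have cs : continuous (fun x => (Num.sqrt (u x))^-1).
  move=> x; apply: cvgV; first exact: s0.
  by apply: continuous_cvg; [exact: sqrt_continuous | exact: su.1].
apply: (@C1_smooth _ (fun v x => - ((Num.sqrt (u x))^-1 * (Num.sqrt (u x))^-1) *:
    ((2^-1 * (Num.sqrt (u x))^-1) * 'D_v u x))) => // v hv.
have [du cu] := smoothP su hv; split=> x.
  have ds : is_derive x v (fun x => Num.sqrt (u x))
      ((2^-1 * (Num.sqrt (u x))^-1) * 'D_v u x).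
    apply: is_derive_comp => //.
    by rewrite -invfM; exact: is_derive1_sqrt.
  case: ds => Dd De; split; first exact: derivableV.
  by rewrite deriveV // De -exprVn expr2.
apply: cvgM; first by apply: cvgN; apply: cvgM; exact: cs.
by apply: cvgM; [apply: cvgM; [exact: cvg_cst|exact: cs] | exact: cu].
Qed.

Lemma is_derive_fst (x v : R * R) : is_derive x v (fst : R * R -> R) v.1.
Proof. by have [D E] := is_derive_id x.1 v.1; split; [exact: D | exact: E]. Qed.

Lemma is_derive_snd (x v : R * R) : is_derive x v (snd : R * R -> R) v.2.
Proof. by have [D E] := is_derive_id x.2 v.2; split; [exact: D | exact: E]. Qed.

(** The case of functions of a single angle, [l] being a coordinate. *)
Section Angle.
Variable l : R * R -> R.
Hypothesis dl : forall x v : R * R, is_derive x v l (l v).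
Hypothesis cl : continuous l.
Variables psi dpsi : R -> R.
Hypothesis dp : forall t : R, is_derive t 1 psi (dpsi t).

Lemma is_derive_angle (x v : R * R) :
  is_derive x v (fun y => psi (2 * pi * l y))
    (dpsi (2 * pi * l x) * (2 * pi * l v)).
Proof.
have [Dl El] := @is_deriveZ _ _ _ _ (2 * pi) _ _ _ (dl x v).
have {}El : 'D_v (fun y => 2 * pi * l y) x = 2 * pi * l v := El.
rewrite -El.
exact: (@is_derive_comp _ psi (fun y => 2 * pi * l y) _ _ _ (dp _) Dl).
Qed.

Lemma smooth_angle : continuous dpsi -> smooth (fun x => psi (2 * pi * l x)).
Proof.
move=> cd.
have c2 : continuous (fun x => 2 * pi * l x).
  by move=> x; apply: cvgM; [exact: cvg_cst | exact: cl].
have cp : continuous psi.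
  move=> t; apply/differentiable_continuous/derivable1_diffP.
  by case: (dp t).
apply: (@C1_smooth _ (fun v x => dpsi (2 * pi * l x) * (2 * pi * l v))).
  by move=> x; exact: (@continuous_cvg _ _ _ _ _ _ psi _ (cp _) (c2 x)).
move=> v _; split=> x; first exact: is_derive_angle.
apply: cvgM; last exact: cvg_cst.
exact: (@continuous_cvg _ _ _ _ _ _ dpsi _ (cd _) (c2 x)).
Qed.

End Angle.

End Smooth.

(** * A criterion for degree 1 *)

Section DegreeOne.
Variable R : realType.
Implicit Types (p : R[i] * R[i]) (q v : R * R).

Lemma chart1E (P : 'M[R[i]]_2) : chart 1 P = P 0 1 / P 1 1.
Proof. by rewrite /chart (_ : rev_ord 1 = 0) //; exact: val_inj. Qed.

Lemma divcR (a b t : R) : (a +i* b) / t%:C = (a / t) +i* (b / t).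
Proof.
by rewrite -fmorphV /=; apply/eqP; rewrite eq_complex /= !mulr0 subr0 add0r !eqxx.
Qed.

Lemma bloch_ray_south (x y z : R) : x ^+ 2 + y ^+ 2 + z ^+ 2 != 0 ->
  bloch_ray x y z = bloch 0 0 (- 1) <-> [/\ x = 0, y = 0 & z < 0].
Proof.
rewrite /bloch_ray; set r := Num.sqrt _ => n0.
have r0 : 0 < r by rewrite sqrtr_gt0 lt_def n0 !addr_ge0 ?sqr_ge0.
have kill (u : R) : u / r / 2 = 0 / 2 -> u = 0.
  by move=> e; rewrite -[u](divfK (lt0r_neq0 r0)) (_ : u / r = 0) ?mul0r //; lra.
split=> [/matrixP E|[x0 y0 z0]].
  have := E 0 0; have := E 0 1; rewrite !mxE /= => -[/kill -> /kill ->] [e0].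
  split=> //; have : z = - r; last by lra.
  by rewrite -[z](divfK (lt0r_neq0 r0)) (_ : z / r = -1) ?mulN1r //; lra.
have -> : r = - z by rewrite /r x0 y0 expr0n /= !add0r sqrtr_sqr ltr0_norm.
by rewrite x0 y0 !mul0r invrN mulrN divff // lt_eqF.
Qed.

Section Criterion.
Variables (f : R[i] * R[i] -> 'M[R[i]]_2) (x y z : R[i] * R[i] -> R) (c : R * R).
Hypothesis fT : torus_map f.
Hypotheses (cx : continuous x) (cy : continuous y) (cz : continuous z).
Hypotheses (sx : smooth (x \o @torus_pt R)) (sy : smooth (y \o @torus_pt R))
  (sz : smooth (z \o @torus_pt R)).
(* The segment from the Bloch vector of f p to (x p, y p, z p) avoids the origin. *)
Hypothesis segment_neq0 : forall p (s : R), torus p -> 0 <= s <= 1 ->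
  ((1 - s) * bloch_x (f p) + s * x p) ^+ 2 +
  ((1 - s) * bloch_y (f p) + s * y p) ^+ 2 +
  ((1 - s) * bloch_z (f p) + s * z p) ^+ 2 != 0.
Hypothesis c01 : 0 <= c.1 < 1 /\ 0 <= c.2 < 1.
Hypothesis fibre_c : forall q, 0 <= q.1 < 1 -> 0 <= q.2 < 1 ->
  [/\ x (torus_pt q) = 0, y (torus_pt q) = 0 & z (torus_pt q) < 0] <-> q = c.
Hypothesis jac_gt0 :
  0 < 'D_(1, 0) (x \o @torus_pt R) c * 'D_(0, 1) (y \o @torus_pt R) c -
      'D_(0, 1) (x \o @torus_pt R) c * 'D_(1, 0) (y \o @torus_pt R) c.

Let g p := bloch_ray (x p) (y p) (z p).
Let norm_sqr q := x (torus_pt q) ^+ 2 + y (torus_pt q) ^+ 2 + z (torus_pt q) ^+ 2.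
Let inv_norm q := (Num.sqrt (norm_sqr q))^-1.

Lemma norm_sqr_neq0 p : torus p -> x p ^+ 2 + y p ^+ 2 + z p ^+ 2 != 0.
Proof.
move=> tp; have := @segment_neq0 p 1 tp; rewrite subrr !mul0r !add0r !mul1r.
by apply; rewrite ler01 lexx.
Qed.

Lemma norm_sqr_gt0 q : 0 < norm_sqr q.
Proof.
by rewrite lt_def norm_sqr_neq0 ?addr_ge0 ?sqr_ge0 //; exact: torus_pt_torus.
Qed.

Lemma smooth_inv_norm : smooth inv_norm.
Proof.
apply: smooth_rsqrt; first exact: norm_sqr_gt0.
by apply: smoothD; [apply: smoothD|]; apply: smoothM.
Qed.

Lemma ref_torus_map : torus_map g.
Proof.
split; last by move=> p tp; apply: bloch_ray_Proj1; exact: norm_sqr_neq0.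
apply/subspace_continuousP => p tp; apply: cvg_bloch_ray; first exact: norm_sqr_neq0.
- by apply: cvg_within_filter; exact: cx.
- by apply: cvg_within_filter; exact: cy.
- by apply: cvg_within_filter; exact: cz.
Qed.

Lemma ref_C1 : torus_C1 g.
Proof.
have s2 u : smooth u -> smooth (fun q => u q / 2).
  by move=> su; apply: smoothM => //; exact: smooth_cst.
have xr := smoothM sx smooth_inv_norm; have yr := smoothM sy smooth_inv_norm.
have zr := smoothM sz smooth_inv_norm.
have s0 := smooth_cst (0 : R); have s1 := smooth_cst (1 : R).
have E i j : (fun q => g (torus_pt q) i j) = fun q =>
    if i == 0 then if j == 0 then ((1 + (z \o @torus_pt R) q * inv_norm q) / 2)%:C
      else ((x \o @torus_pt R) q * inv_norm q / 2)
             +i* ((y \o @torus_pt R) q * inv_norm q / 2)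
    else if j == 0 then ((x \o @torus_pt R) q * inv_norm q / 2)
                          -i* ((y \o @torus_pt R) q * inv_norm q / 2)
      else ((1 - (z \o @torus_pt R) q * inv_norm q) / 2)%:C.
  by apply/funext => q; rewrite mxE.
move=> i j.
have -> : (fun q => complex.Re (g (torus_pt q) i j)) =
    (@complex.Re R) \o (fun q => g (torus_pt q) i j) by [].
have -> : (fun q => complex.Im (g (torus_pt q) i j)) =
    (@complex.Im R) \o (fun q => g (torus_pt q) i j) by [].
rewrite E; case: (i == 0); case: (j == 0); split.
- exact: (s2 _ (smoothD s1 zr)).2.
- exact: s0.2.
- exact: (s2 _ xr).2.
- exact: (s2 _ yr).2.
- exact: (s2 _ xr).2.
- rewrite (_ : _ \o _ = fun q => 0 - (y \o @torus_pt R) q * inv_norm q / 2).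
    exact: (smoothB s0 (s2 _ yr)).2.
  by apply/funext => q /=; rewrite sub0r.
- exact: (s2 _ (smoothB s1 zr)).2.
- exact: s0.2.
Qed.

(** The straight segment between the two vector fields, normalized. *)
Lemma homotopic_ref : torus_homotopic f g.
Proof.
have [bx by_ bz] := bloch_coord_continuous R.
exists (fun sp => bloch_ray ((1 - sp.1) * bloch_x (f sp.2) + sp.1 * x sp.2)
  ((1 - sp.1) * bloch_y (f sp.2) + sp.1 * y sp.2)
  ((1 - sp.1) * bloch_z (f sp.2) + sp.1 * z sp.2)); split.
- apply/subspace_continuousP => -[s p] [/=]; rewrite in_itv /= => s01 tp.
  have c1 : sp.1 @[sp --> within (`[0, 1] `*` @torus R) (nbhs (s, p))] --> s.
    by apply: cvg_within_filter; exact: cvg_fst.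
  have c2 (u : R[i] * R[i] -> R) : continuous u ->
      u sp.2 @[sp --> within (`[0, 1] `*` @torus R) (nbhs (s, p))] --> u p.
    move=> cu; apply: cvg_within_filter.
    by apply: (@cvg_comp _ _ _ snd u _ (nbhs p)); [exact: cvg_snd | exact: cu].
  have cf : f sp.2 @[sp --> within (`[0, 1] `*` @torus R) (nbhs (s, p))] --> f p.
    apply: (@cvg_comp _ _ _ snd f _ (within (@torus R) (nbhs p))).
      move=> B nB.
      have H : nbhs (s, p) (fun sp : R * (R[i] * R[i]) => torus sp.2 -> B sp.2).
        exact: (@cvg_snd _ _ (nbhs s) (nbhs p) _ _ nB).
      by apply: (@filterS _ (nbhs (s, p)) _ _ _ _ H) => sp h [_ tsp]; exact: h.
    by have /subspace_continuousP := fT.1; apply.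
  have c3 (b : 'M[R[i]]_2 -> R) (u : R[i] * R[i] -> R) :
      continuous b -> continuous u ->
      (1 - sp.1) * b (f sp.2) + sp.1 * u sp.2
        @[sp --> within (`[0, 1] `*` @torus R) (nbhs (s, p))] -->
      (1 - s) * b (f p) + s * u p.
    move=> cb cu; apply: cvgD; apply: cvgM => //.
    - by apply: cvgB => //; exact: cvg_cst.
    - by apply: continuous_cvg => //; exact: cb.
    - exact: c2.
  by apply: cvg_bloch_ray; [exact: segment_neq0 | exact: c3 | exact: c3 | exact: c3].
- by move=> s p s01 tp; apply: bloch_ray_Proj1; exact: segment_neq0.
- move=> p tp /=; rewrite subr0 !mul1r !mul0r !addr0.
  by have [fE f1] := Proj1_bloch (fT.2 _ tp); rewrite bloch_ray_unit // -fE.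
- by move=> p tp /=; rewrite subrr !mul0r !add0r !mul1r.
Qed.

Lemma fibre_ref : fibre g (bloch 0 0 (- 1)) = [set c].
Proof.
rewrite predeqE => q; rewrite /fibre /=; split=> [[q1 q2]|->].
  move/bloch_ray_south => /(_ (norm_sqr_neq0 (torus_pt_torus q))).
  exact: (fibre_c q1 q2).1.
have [c1 c2] := c01; split=> //; apply/bloch_ray_south.
  exact: norm_sqr_neq0 (torus_pt_torus c).
exact: (fibre_c c1 c2).2.
Qed.

(** Near [c] the coordinate of P^1(C) is (x + i y) w for a positive function w.
Since x and y vanish at [c], the derivatives of w drop out. *)
Lemma jacobian_ref_gt0 : 0 < Defs.jacobian 1 g c.
Proof.
have [[c1 c2] [xc yc zc]] := (c01, (fibre_c c01.1 c01.2).2 erefl).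
pose w q := inv_norm q * (1 - (z \o @torus_pt R) q * inv_norm q)^-1.
(* With r = 1 / inv_norm the norm, x w is x / r divided by 1 - z / r. *)
have chartE q : chart 1 (g (torus_pt q)) =
    ((x \o @torus_pt R) q * w q) +i* ((y \o @torus_pt R) q * w q).
  rewrite chart1E /g !mxE /= divcR /w.
  rewrite -/(norm_sqr q) -/(inv_norm q).
  by congr (_ +i* _); rewrite invfM invrK [_^-1 * 2]mulrC -!mulrA mulKf ?pnatr_eq0.
have irc : 0 < inv_norm c by rewrite invr_gt0 sqrtr_gt0 norm_sqr_gt0.
have zirc : 0 < 1 - (z \o @torus_pt R) c * inv_norm c.
  by rewrite subr_gt0 (lt_trans _ ltr01) // nmulr_rlt0.
have wc : 0 < w c by rewrite mulr_gt0 // invr_gt0.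
have dw v : v = (1, 0) \/ v = (0, 1) -> derivable w c v.
  move=> hv; apply: derivableM; first exact: (smoothP smooth_inv_norm hv).1.
  apply: derivableV; first by rewrite gt_eqF.
  exact: (smoothP (smoothB (smooth_cst 1) (smoothM sz smooth_inv_norm)) hv).1.
have dE u v : u c = 0 -> smooth u -> v = (1, 0) \/ v = (0, 1) ->
    'D_v (fun q => u q * w q) c = w c * 'D_v u c.
  move=> uc su hv; rewrite deriveM; last exact: dw.
    by rewrite uc scale0r add0r.
  exact: (smoothP su hv).1.
have Re_chart : (fun q => complex.Re (chart 1 (g (torus_pt q)))) =
    fun q => (x \o @torus_pt R) q * w q by apply/funext => q; rewrite chartE.
have Im_chart : (fun q => complex.Im (chart 1 (g (torus_pt q)))) =
    fun q => (y \o @torus_pt R) q * w q by apply/funext => q; rewrite chartE.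
rewrite /Defs.jacobian Re_chart Im_chart !dE //; try by [left|right].
rewrite (_ : _ - _ = w c ^+ 2 *
     ('D_(1, 0) (x \o @torus_pt R) c * 'D_(0, 1) (y \o @torus_pt R) c -
      'D_(0, 1) (x \o @torus_pt R) c * 'D_(1, 0) (y \o @torus_pt R) c)); last by ring.
by rewrite mulr_gt0 // exprn_gt0.
Qed.

(** If the vector field (x, y, z) can be joined to the Bloch vectors of [f] by
segments that avoid the origin, meets the negative vertical axis only at [c],
and its horizontal part preserves orientation there, then the fibre over the
south pole shows that the degree of [f] is 1. *)
Lemma degree1_criterion : has_degree f 1.
Proof.
exists g; split; [exact: ref_torus_map | exact: ref_C1 | exact: homotopic_ref |].
exists (bloch 0 0 (- 1)), 1; rewrite fibre_ref; split.
- by apply: bloch_Proj1; rewrite sqrrN !expr0n !expr1n !add0r.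
- by rewrite mxE /= opprK eq_complex /= divff // oner_eq0.
- exact: finite_set1.
- by move=> q ->; rewrite gt_eqF // jacobian_ref_gt0.
- by rewrite fsbig_set1 gtr0_sgz // jacobian_ref_gt0.
Qed.

End Criterion.
End DegreeOne.

(** * Trigonometric functions of the two angles *)

Section Trigonometry.
Variable R : realType.
Implicit Types (q v : R * R) (t : R).

Let cos1 q : R := cos (2 * pi * q.1).
Let sin1 q : R := sin (2 * pi * q.1).
Let cos2 q : R := cos (2 * pi * q.2).
Let sin2 q : R := sin (2 * pi * q.2).
Let half : R * R := (1 / 2, 1 / 2).

Lemma continuous_msin : continuous (fun t : R => - sin t).
Proof. by move=> t; apply: cvgN; exact: continuous_sin. Qed.

Lemma fst_continuous : continuous (fst : R * R -> R).
Proof. by move=> q; exact: cvg_fst. Qed.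

Lemma snd_continuous : continuous (snd : R * R -> R).
Proof. by move=> q; exact: cvg_snd. Qed.

Lemma smooth_trig : [/\ smooth cos1, smooth sin1, smooth cos2 & smooth sin2].
Proof.
split.
- exact: (smooth_angle (@is_derive_fst R) fst_continuous
    (@is_derive_cos R) continuous_msin).
- exact: (smooth_angle (@is_derive_fst R) fst_continuous
    (@is_derive_sin R) (@continuous_cos R)).
- exact: (smooth_angle (@is_derive_snd R) snd_continuous
    (@is_derive_cos R) continuous_msin).
- exact: (smooth_angle (@is_derive_snd R) snd_continuous
    (@is_derive_sin R) (@continuous_cos R)).
Qed.

Lemma cos_half : cos (2 * pi * (1 / 2)) = - 1 :> R.
Proof. by rewrite (_ : _ * _ = pi) ?cospi //; field. Qed.

Lemma sin_half : sin (2 * pi * (1 / 2)) = 0 :> R.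
Proof. by rewrite (_ : _ * _ = pi) ?sinpi //; field. Qed.

Lemma derive_trig_half v :
  [/\ is_derive half v cos1 0, is_derive half v sin1 (- (2 * pi * v.1)),
      is_derive half v cos2 0 & is_derive half v sin2 (- (2 * pi * v.2))].
Proof.
have dc1 := is_derive_angle (@is_derive_fst R) (@is_derive_cos R) half v.
have ds1 := is_derive_angle (@is_derive_fst R) (@is_derive_sin R) half v.
have dc2 := is_derive_angle (@is_derive_snd R) (@is_derive_cos R) half v.
have ds2 := is_derive_angle (@is_derive_snd R) (@is_derive_sin R) half v.
move: dc1 ds1 dc2 ds2.
by rewrite /half /= cos_half sin_half oppr0 !mul0r !mulN1r; split.
Qed.

Lemma half_unique q : 0 <= q.1 < 1 -> 0 <= q.2 < 1 ->
  cos1 q = -1 -> sin1 q = 0 -> cos2 q = -1 -> sin2 q = 0 -> q = half.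
Proof.
have one t : 0 <= t < 1 -> cos (2 * pi * t) = -1 -> sin (2 * pi * t) = 0 ->
    t = 1 / 2.
  move=> /andP[t0 t1] ct st.
  have t01 : 0 <= t <= 1 by rewrite t0 ltW.
  have h01 : 0 <= (1 / 2 : R) <= 1 by lra.
  have e : cis t = cis (1 / 2) by rewrite /cis ct st cos_half sin_half.
  by case: (cis_inj t01 h01 e) => [//|[_]|[_]]; lra.
by case: q => q1 q2 /= h1 h2 c1 s1 c2 s2; congr (_, _); exact: one.
Qed.

Lemma sum_sq_eq0 (x y z : R) : x ^+ 2 + y ^+ 2 + z ^+ 2 = 0 ->
  [/\ x = 0, y = 0 & z = 0].
Proof.
move=> s; have sx := sqr_ge0 x; have sy := sqr_ge0 y; have sz := sqr_ge0 z.
by split; apply/eqP; rewrite -sqrf_eq0; apply/eqP; lra.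
Qed.

Lemma blochK (x y z : R) :
  [/\ bloch_x (bloch x y z) = x, bloch_y (bloch x y z) = y &
      bloch_z (bloch x y z) = z].
Proof. by rewrite /bloch_x /bloch_y /bloch_z !mxE /=; split; field. Qed.

Lemma sin_gt0_half t : 0 < t < 1 / 2 -> 0 < sin (2 * pi * t).
Proof.
move=> /andP[t0 t1]; have pi0 := pi_gt0 R; apply: sin_gt0_pi.
by rewrite !mulr_gt0 //=; nra.
Qed.

Lemma sin_lt0_half t : 1 / 2 < t < 1 -> sin (2 * pi * t) < 0.
Proof.
move=> /andP[t0 t1]; have pi0 := pi_gt0 R.
rewrite (_ : 2 * pi * t = 2 * pi * (t - 1 / 2) + pi :> R); last by field.
by rewrite sinDpi oppr_lt0; apply: sin_gt0_half; lra.
Qed.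

Lemma torus_coord_continuous :
  [/\ continuous (fun p : R[i] * R[i] => complex.Re p.1),
      continuous (fun p : R[i] * R[i] => complex.Im p.1),
      continuous (fun p : R[i] * R[i] => complex.Re p.2) &
      continuous (fun p : R[i] * R[i] => complex.Im p.2)].
Proof.
split=> p.
- exact: (@cvg_comp _ _ _ fst (@complex.Re R) _ (nbhs p.1) _ cvg_fst
    (@Re_continuous R _)).
- exact: (@cvg_comp _ _ _ fst (@complex.Im R) _ (nbhs p.1) _ cvg_fst
    (@Im_continuous R _)).
- exact: (@cvg_comp _ _ _ snd (@complex.Re R) _ (nbhs p.2) _ cvg_snd
    (@Re_continuous R _)).
- exact: (@cvg_comp _ _ _ snd (@complex.Im R) _ (nbhs p.2) _ cvg_snd
    (@Im_continuous R _)).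
Qed.

Lemma diagonal_jacobian_gt0 (X Y : R * R -> R) (c : R * R) (al be : R) :
  (forall v, is_derive c v X (al * v.1)) ->
  (forall v, is_derive c v Y (be * v.2)) -> 0 < al * be ->
  0 < 'D_(1, 0) X c * 'D_(0, 1) Y c - 'D_(0, 1) X c * 'D_(1, 0) Y c.
Proof.
move=> dX dY ab0.
have [_ ->] := dX (1, 0); have [_ ->] := dX (0, 1).
have [_ ->] := dY (1, 0); have [_ ->] := dY (0, 1).
by rewrite /= !mulr0 subr0 !mulr1.
Qed.

End Trigonometry.

(** * The projection P_L *)

Section Loring.
Variable R : realType.
Variable a : R -> R.
Hypothesis ha : loring_function a.
Implicit Types (q v : R * R) (t : R).

Definition PL_x q : R :=
  2 * (loring_b a q.1 + loring_beta a q.1 * cos (2 * pi * q.2)).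
Definition PL_y q : R := 2 * (loring_beta a q.1 * sin (2 * pi * q.2)).
Definition PL_z q : R := 2 * a q.1 - 1.

Lemma PL_bloch q : PL a q = bloch (PL_x q) (PL_y q) (PL_z q).
Proof.
rewrite /PL /PL_x /PL_y /PL_z; apply: mx2P; rewrite !mxE /=;
  apply/eqP; rewrite eq_complex /=;
  rewrite ?mulrN ?cosN ?sinN; apply/andP; split; apply/eqP; lra.
Qed.

Lemma loring_gap_ge0 t : 0 <= a t - a t ^+ 2.
Proof. by case: ha => _ _ /(_ t) h _ _; nra. Qed.

Lemma loring_sqr t :
  (t <= 1 / 2 /\ [/\ loring_b a t ^+ 2 = a t - a t ^+ 2, 0 <= loring_b a t &
                     loring_beta a t = 0]) \/
  (1 / 2 < t /\ [/\ loring_b a t = 0, loring_beta a t ^+ 2 = a t - a t ^+ 2 &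
                    0 <= loring_beta a t]).
Proof.
rewrite /loring_b /loring_beta; case: leP => h; [left|right]; split=> //;
  by rewrite sqr_sqrtr ?loring_gap_ge0 // sqrtr_ge0.
Qed.

Lemma PL_unit q : PL_x q ^+ 2 + PL_y q ^+ 2 + PL_z q ^+ 2 = 1.
Proof.
have := cos2Dsin2 (2 * pi * q.2); rewrite /PL_x /PL_y /PL_z.
set c := cos _; set s := sin _ => cs.
by case: (loring_sqr q.1) => -[_ [h1 h2 h3]]; rewrite ?h1 ?h3; nra.
Qed.

Lemma loring_values : [/\ a 0 = 1, a (1 / 2) = 0 & a 1 = 1].
Proof. by case: ha. Qed.

Lemma loring_continuous : continuous a.
Proof. by case: ha. Qed.

(** Since a(1/2) = 0, the functions b and beta are obtained from sqrt(a - a^2) by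
freezing the argument at 1/2 on one side, that is with m a minimum or a
maximum below. *)
Lemma sqrt_arc_continuous (m : R -> R) : continuous m ->
  continuous (fun t => Num.sqrt (a (m t) - a (m t) ^+ 2)).
Proof.
move=> cm t.
have ca : a (m u) @[u --> t] --> a (m t).
  exact: (@cvg_comp _ _ _ m a _ (nbhs (m t)) _ (cm t) (@loring_continuous (m t))).
have cr : a (m u) - a (m u) ^+ 2 @[u --> t] --> a (m t) - a (m t) ^+ 2.
  by apply: cvgB => //; apply: cvgM.
exact: (@cvg_comp _ _ _ (fun u => a (m u) - a (m u) ^+ 2) Num.sqrt _ (nbhs _) _
  cr (@sqrt_continuous R _)).
Qed.

Lemma loring_b_continuous : continuous (loring_b a).
Proof.
rewrite (_ : loring_b a = fun t =>
    Num.sqrt (a (Num.min t (1 / 2)) - a (Num.min t (1 / 2)) ^+ 2)).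
  apply: sqrt_arc_continuous => t.
  exact: (@continuous_min _ _ id (fun=> 1 / 2) t cvg_id (@cvg_cst _ _ _ _ _)).
apply/funext => t; rewrite /loring_b; case: leP => // _.
by have [_ -> _] := loring_values; rewrite expr0n subr0 sqrtr0.
Qed.

Lemma loring_beta_continuous : continuous (loring_beta a).
Proof.
rewrite (_ : loring_beta a = fun t =>
    Num.sqrt (a (Num.max t (1 / 2)) - a (Num.max t (1 / 2)) ^+ 2)).
  apply: sqrt_arc_continuous => t.
  exact: (@continuous_max _ _ id (fun=> 1 / 2) t cvg_id (@cvg_cst _ _ _ _ _)).
apply/funext => t; rewrite /loring_beta; case: leP => // _.
by have [_ -> _] := loring_values; rewrite expr0n subr0 sqrtr0.
Qed.

Lemma PL_continuous : continuous (PL a).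
Proof.
move=> q; rewrite (_ : PL a = fun q => bloch (PL_x q) (PL_y q) (PL_z q));
  last by apply/funext => ?; exact: PL_bloch.
have c1 (g : R -> R) : continuous g -> g q.1 @[q --> q] --> g q.1.
  by move=> cg; exact: (@cvg_comp _ _ _ fst g _ (nbhs q.1) _ cvg_fst (cg q.1)).
have cb := c1 _ loring_b_continuous; have cbeta := c1 _ loring_beta_continuous.
have ca := c1 _ loring_continuous.
have [_ _ [cc _] [cs _]] := smooth_trig R.
have k2 : (2 : R) @[q --> q] --> (2 : R) by exact: cvg_cst.
apply: cvg_bloch.
- by apply: cvgM => //; apply: cvgD => //; apply: cvgM => //; exact: cc.
- by apply: cvgM => //; apply: cvgM => //; exact: cs.
- by apply: cvgB; [apply: cvgM | exact: cvg_cst].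
Qed.

Lemma loring_ends : [/\ loring_b a 0 = 0, loring_beta a 0 = 0, loring_b a 1 = 0 &
  loring_beta a 1 = 0].
Proof.
have [a0 _ a1] := loring_values; rewrite /loring_b /loring_beta a0 a1 expr1n subrr.
by rewrite sqrtr0 !if_same.
Qed.

Lemma ex_PL : exists f, induces (PL a) f.
Proof.
apply: ex_induces; first exact: PL_continuous.
- by move=> q _; rewrite PL_bloch; apply: bloch_Proj1; exact: PL_unit.
- move=> t _; rewrite !PL_bloch /PL_x /PL_y /PL_z /=.
  by have [-> -> -> ->] := loring_ends; have [-> _ ->] := loring_values; rewrite !mul0r.
- move=> t _; rewrite !PL_bloch /PL_x /PL_y /=.
  by rewrite mulr0 mulr1 [2 * pi]mulr_natl cos2pi sin2pi cos0 sin0.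
Qed.

(** The smooth weights 1 + s1 and 1 - s1 stand for b and beta. *)
Definition PL_ref_x (p : R[i] * R[i]) : R :=
  (1 + complex.Im p.1) + (1 - complex.Im p.1) * complex.Re p.2.
Definition PL_ref_y (p : R[i] * R[i]) : R := (1 - complex.Im p.1) * complex.Im p.2.
Definition PL_ref_z (p : R[i] * R[i]) : R := complex.Re p.1.

(** At theta = 0, 1/2, 1 both vectors have the same nonzero height.  Elsewhere
their horizontal parts have scalar products >= 0 and > 0 with a common
direction: (1, 0) if theta < 1/2, and exp(2 pi i phi) if theta > 1/2.  So the
combination could vanish only for s = 0, where it is a unit vector. *)
Lemma PL_segment_neq0 q s : 0 <= q.1 <= 1 -> 0 <= s <= 1 ->
  ((1 - s) * PL_x q + s * PL_ref_x (torus_pt q)) ^+ 2 +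
  ((1 - s) * PL_y q + s * PL_ref_y (torus_pt q)) ^+ 2 +
  ((1 - s) * PL_z q + s * PL_ref_z (torus_pt q)) ^+ 2 != 0.
Proof.
move=> /andP[q0 q1] /andP[s0 s1]; apply/eqP => /sum_sq_eq0.
have := PL_unit q; rewrite /PL_ref_x /PL_ref_y /PL_ref_z /PL_x /PL_y /PL_z /=.
have := cos2Dsin2 (2 * pi * q.1); have := cos2Dsin2 (2 * pi * q.2).
have := @sin_gt0_half R q.1; have := @sin_lt0_half R q.1.
have [a0 ah a1] := loring_values.
have [q10|q10] := eqVneq q.1 0.
  by rewrite q10 mulr0 cos0 sin0 a0 => _ _ _ _ _ [_ _]; lra.
have [q11|q11] := eqVneq q.1 1.
  by rewrite q11 mulr1 [2 * pi]mulr_natl cos2pi sin2pi a1 => _ _ _ _ _ [_ _]; lra.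
have [q1h|q1h] := eqVneq q.1 (1 / 2).
  by rewrite q1h cos_half sin_half ah => _ _ _ _ _ [_ _]; lra.
set C1 := cos (2 * pi * q.1); set S1 := sin (2 * pi * q.1).
set C2 := cos (2 * pi * q.2); set S2 := sin (2 * pi * q.2).
move=> neg pos cs2 cs1 nz [X0 Y0 Z0].
have [s_eq0|s_neq0] := eqVneq s 0.
  move: X0 Y0 Z0; rewrite s_eq0 subr0 !mul1r !mul0r !addr0 => X0 Y0 Z0.
  by rewrite X0 Y0 Z0 in nz; lra.
have sp : 0 < s by rewrite lt_def s_neq0.
case: (loring_sqr q.1) => -[hq [h1 h2 h3]].
  have S1p : 0 < S1 by apply: pos; lra.
  have X1 : 0 < s * (1 + S1 + (1 - S1) * C2) by apply: mulr_gt0 => //; nra.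
  have X2 : 0 <= (1 - s) * (2 * (loring_b a q.1 + loring_beta a q.1 * C2)).
    by rewrite h3 mul0r addr0; apply: mulr_ge0; lra.
  lra.
have S1n : S1 < 0 by apply: neg; lra.
(* The scalar product with (C2, S2) of the vanishing horizontal part. *)
have XY : (1 - s) * (2 * loring_beta a q.1) + s * ((1 + S1) * C2 + (1 - S1)) = 0.
  have e : (1 - s) * (2 * loring_beta a q.1) * (C2 ^+ 2 + S2 ^+ 2) +
      s * ((1 + S1) * C2 + (1 - S1) * (C2 ^+ 2 + S2 ^+ 2)) = C2 * 0 + S2 * 0.
    by rewrite -[in X in C2 * X]X0 -[in X in S2 * X]Y0 h1; ring.
  by move: e; rewrite cs2 !mulr1 !mulr0 addr0.
(* As -1 <= C2 and -1 <= S1, the last factor is at least - 2 S1. *)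
have X1 : 0 < s * ((1 + S1) * C2 + (1 - S1)) by apply: mulr_gt0 => //; nra.
have X2 : 0 <= (1 - s) * (2 * loring_beta a q.1) by apply: mulr_ge0; lra.
lra.
Qed.

Lemma PL_ref_south q : 0 <= q.1 < 1 -> 0 <= q.2 < 1 ->
  [/\ PL_ref_x (torus_pt q) = 0, PL_ref_y (torus_pt q) = 0 &
      PL_ref_z (torus_pt q) < 0] <-> q = (1 / 2, 1 / 2).
Proof.
move=> q1 q2; rewrite /PL_ref_x /PL_ref_y /PL_ref_z /=; split; last first.
  by move=> -> /=; rewrite cos_half sin_half; split; lra.
have := cos2Dsin2 (2 * pi * q.1); have := cos2Dsin2 (2 * pi * q.2).
move: (@half_unique R q q1 q2) => /=.
set C1 := cos (2 * pi * q.1); set S1 := sin (2 * pi * q.1).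
set C2 := cos (2 * pi * q.2); set S2 := sin (2 * pi * q.2).
move=> uniq cs2 cs1 [x0 y0 z0].
have S1lt : S1 < 1 by nra.
have S20 : S2 = 0.
  by move/eqP: y0; rewrite mulf_eq0 subr_eq0 (gt_eqF S1lt) => /eqP.
have C2E : C2 = -1.
  have /eqP : (C2 - 1) * (C2 + 1) = 0 by move: cs2; rewrite S20 => cs2; lra.
  rewrite mulf_eq0 subr_eq0 addr_eq0 => /orP[] /eqP // C21.
  by move: x0; rewrite C21; lra.
have S10 : S1 = 0 by move: x0; rewrite C2E; lra.
have C1E : C1 = -1.
  have /eqP : (C1 - 1) * (C1 + 1) = 0 by move: cs1; rewrite S10 => cs1; lra.
  rewrite mulf_eq0 subr_eq0 addr_eq0 => /orP[] /eqP // C11.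
  by move: z0; rewrite C11; lra.
exact: uniq.
Qed.

Lemma PL_ref_derive v :
  is_derive ((1 / 2, 1 / 2) : R * R) v (PL_ref_x \o @torus_pt R)
    (- (4 * pi) * v.1) /\
  is_derive ((1 / 2, 1 / 2) : R * R) v (PL_ref_y \o @torus_pt R)
    (- (2 * pi) * v.2).
Proof.
have [dc1 ds1 dc2 ds2] := @derive_trig_half R v.
have d1 := is_derive_cst (1 : R) ((1 / 2, 1 / 2) : R * R) v.
split.
  apply: (is_derive_eq (is_deriveD (is_deriveD d1 ds1)
    (is_deriveM (is_deriveB d1 ds1) dc2))).
  rewrite /= /GRing.scale /= cos_half; ring.
apply: (is_derive_eq (is_deriveM (is_deriveB d1 ds1) ds2)).
rewrite !fctE /= /GRing.scale /= sin_half; ring.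
Qed.

Lemma PL_degree f : induces (PL a) f -> has_degree f 1.
Proof.
move=> [fT fE].
have [sc1 ss1 sc2 ss2] := smooth_trig R.
have s1 := smooth_cst (1 : R).
have [cRe1 cIm1 cRe2 cIm2] := torus_coord_continuous R.
have k1 (p : R[i] * R[i]) : (1 : R) @[p --> p] --> (1 : R) by exact: cvg_cst.
apply: (@degree1_criterion R f PL_ref_x PL_ref_y PL_ref_z (1 / 2, 1 / 2)).
- exact: fT.
- move=> p; exact: (cvgD (cvgD (k1 p) (cIm1 p))
    (cvgM (cvgB (k1 p) (cIm1 p)) (cRe2 p))).
- by move=> p; exact: (cvgM (cvgB (k1 p) (cIm1 p)) (cIm2 p)).
- exact: cRe1.
- exact: (smoothD (smoothD s1 ss1) (smoothM (smoothB s1 ss1) sc2)).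
- exact: (smoothM (smoothB s1 ss1) ss2).
- exact: sc1.
- move=> p s /torus_pt_surj[q /unit_squareP[q1 q2] <-] s01.
  rewrite fE // PL_bloch; have [-> -> ->] := blochK (PL_x q) (PL_y q) (PL_z q).
  exact: PL_segment_neq0.
- by split=> /=; lra.
- exact: PL_ref_south.
- have pi0 := pi_gt0 R.
  apply: (@diagonal_jacobian_gt0 R _ _ _ (- (4 * pi)) (- (2 * pi))).
  + by move=> v; exact: (PL_ref_derive v).1.
  + by move=> v; exact: (PL_ref_derive v).2.
  + by nra.
Qed.
End Loring.

(** * The projection P_I *)

Section ProjectionI.
Variable R : realType.
Implicit Types (q v : R * R) (t : R).

Definition PI_t q : R := (1 - cos (2 * pi * q.1)) * (1 - cos (2 * pi * q.2)).
Definition PI_x q : R := sin (2 * pi * q.1) * (1 - cos (2 * pi * q.2)) / 2.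
Definition PI_y q : R :=
  sin (2 * pi * q.2) * Num.sqrt (2 * (1 - cos (2 * pi * q.1))) / 2.
Definition PI_z q : R := 1 - PI_t q / 2.

Lemma PI_bloch q : PI q = bloch (PI_x q) (PI_y q) (PI_z q).
Proof.
have scale4 (u w : R) : 1 / 4 * (u +i* w) = (u / 4) +i* (w / 4).
  rewrite mul1r -[4 in LHS](rmorph_nat (real_complex R) 4).
  by rewrite mulrC divcR.
rewrite /PI /PI_x /PI_y /PI_z /PI_t; apply: mx2P; rewrite !mxE /= scale4 /=;
  apply/eqP; rewrite eq_complex /=; apply/andP; split; apply/eqP; lra.
Qed.

Lemma PI_unit q : PI_x q ^+ 2 + PI_y q ^+ 2 + PI_z q ^+ 2 = 1.
Proof.
have := cos2Dsin2 (2 * pi * q.1); have := cos2Dsin2 (2 * pi * q.2).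
have := cos_le1 (2 * pi * q.1).
rewrite /PI_x /PI_y /PI_z /PI_t.
set C1 := cos (2 * pi * q.1); set S1 := sin (2 * pi * q.1).
set C2 := cos (2 * pi * q.2); set S2 := sin (2 * pi * q.2).
move=> C1le cs2 cs1.
have sq : Num.sqrt (2 * (1 - C1)) ^+ 2 = 2 * (1 - C1) by rewrite sqr_sqrtr; lra.
have S1E : S1 ^+ 2 = 1 - C1 ^+ 2 by lra.
have S2E : S2 ^+ 2 = 1 - C2 ^+ 2 by lra.
by rewrite !expr_div_n !exprMn sq S1E S2E; lra.
Qed.

Lemma PI_continuous : continuous (@PI R).
Proof.
move=> q; rewrite (_ : @PI R = fun q => bloch (PI_x q) (PI_y q) (PI_z q));
  last by apply/funext => ?; exact: PI_bloch.
have [[cc1 _] [cs1 _] [cc2 _] [cs2 _]] := smooth_trig R.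
have k (c : R) : c @[q --> q] --> c by exact: cvg_cst.
have B1 := cvgB (k 1) (cc1 q); have B2 := cvgB (k 1) (cc2 q).
apply: cvg_bloch.
- by apply: cvgM; [apply: cvgM; [exact: cs1 | exact: B2] | exact: k].
- have c2 : 2 * (1 - cos (2 * pi * u.1)) @[u --> q] --> 2 * (1 - cos (2 * pi * q.1)).
    by apply: cvgM; [exact: k | exact: B1].
  have cr : Num.sqrt (2 * (1 - cos (2 * pi * u.1))) @[u --> q] -->
            Num.sqrt (2 * (1 - cos (2 * pi * q.1))).
    exact: (@cvg_comp _ _ _ (fun u : R * R => 2 * (1 - cos (2 * pi * u.1))) Num.sqrt
      _ (nbhs _) _ c2 (@sqrt_continuous R _)).
  by apply: cvgM; [apply: cvgM; [exact: cs2 | exact: cr] | exact: k].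
- apply: cvgB; first exact: k.
  by apply: cvgM; [apply: cvgM; [exact: B1 | exact: B2] | exact: k].
Qed.

Lemma ex_PI : exists f, induces (@PI R) f.
Proof.
apply: ex_induces; first exact: PI_continuous.
- by move=> q _; rewrite PI_bloch; apply: bloch_Proj1; exact: PI_unit.
- move=> t _; rewrite !PI_bloch /PI_x /PI_y /PI_z /PI_t /=.
  by rewrite mulr0 mulr1 [2 * pi]mulr_natl cos2pi sin2pi cos0 sin0.
- move=> t _; rewrite !PI_bloch /PI_x /PI_y /PI_z /PI_t /=.
  by rewrite mulr0 mulr1 [2 * pi]mulr_natl cos2pi sin2pi cos0 sin0.
Qed.

(** Twice the Bloch vector of P_I, the square root being replaced by
1 - cos(2 pi theta). *)
Definition PI_ref_x (p : R[i] * R[i]) : R := complex.Im p.1 * (1 - complex.Re p.2).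
Definition PI_ref_y (p : R[i] * R[i]) : R := complex.Im p.2 * (1 - complex.Re p.1).
Definition PI_ref_z (p : R[i] * R[i]) : R :=
  2 - (1 - complex.Re p.1) * (1 - complex.Re p.2).

(** The first and third coordinates of the two vectors are proportional, with a
positive ratio.  They vanish together only for c1 = -1, c2 = 0, and there the
second coordinates have the sign of s2, which is not zero. *)
Lemma PI_segment_neq0 q s : 0 <= s <= 1 ->
  ((1 - s) * PI_x q + s * PI_ref_x (torus_pt q)) ^+ 2 +
  ((1 - s) * PI_y q + s * PI_ref_y (torus_pt q)) ^+ 2 +
  ((1 - s) * PI_z q + s * PI_ref_z (torus_pt q)) ^+ 2 != 0.
Proof.
move=> /andP[s0 s1]; apply/eqP => /sum_sq_eq0.
rewrite /PI_ref_x /PI_ref_y /PI_ref_z /PI_x /PI_y /PI_z /PI_t /=.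
have := cos2Dsin2 (2 * pi * q.1); have := cos2Dsin2 (2 * pi * q.2).
set C1 := cos (2 * pi * q.1); set S1 := sin (2 * pi * q.1).
set C2 := cos (2 * pi * q.2); set S2 := sin (2 * pi * q.2).
move=> cs2 cs1 [X0 Y0 Z0].
have T2 : (1 - C1) * (1 - C2) = 2.
  have /eqP : ((1 - s) / 2 + s) * (2 - (1 - C1) * (1 - C2)) = 0.
    by rewrite -[RHS]Z0; field.
  by rewrite mulf_eq0 => /orP[] /eqP; lra.
have S10 : S1 = 0.
  have /eqP : ((1 - s) / 2 + s) * (1 - C2) * S1 = 0 by rewrite -[RHS]X0; field.
  rewrite !mulf_eq0 => /orP[/orP[]|] /eqP //; first by lra.
  by move=> e; move: T2; rewrite e; lra.
have C1E : C1 = -1.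
  have /eqP : (1 - C1) * (C1 + 1) = 0 by move: cs1; rewrite S10; lra.
  rewrite mulf_eq0 => /orP[] /eqP e; last by lra.
  by move: T2; rewrite e; lra.
have C20 : C2 = 0 by move: T2; rewrite C1E; lra.
have r2 : Num.sqrt (2 * (1 - C1)) = 2.
  rewrite C1E (_ : 2 * (1 - -1) = 2 ^+ 2) ?sqrtr_sqr ?ger0_norm //; lra.
have /eqP : ((1 - s) + s * 2) * S2 = 0 by rewrite -[RHS]Y0 r2 C1E; field.
rewrite mulf_eq0 => /orP[] /eqP e; first by lra.
by move: cs2; rewrite e C20; lra.
Qed.

(** A negative height excludes c1 = 1 and c2 = 1, so the horizontal part vanishes
only with s1 = s2 = 0. *)
Lemma PI_ref_south q : 0 <= q.1 < 1 -> 0 <= q.2 < 1 ->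
  [/\ PI_ref_x (torus_pt q) = 0, PI_ref_y (torus_pt q) = 0 &
      PI_ref_z (torus_pt q) < 0] <-> q = (1 / 2, 1 / 2).
Proof.
move=> q1 q2; rewrite /PI_ref_x /PI_ref_y /PI_ref_z /=; split; last first.
  by move=> -> /=; rewrite cos_half sin_half; split; lra.
have := cos2Dsin2 (2 * pi * q.1); have := cos2Dsin2 (2 * pi * q.2).
move: (@half_unique R q q1 q2) => /=.
set C1 := cos (2 * pi * q.1); set S1 := sin (2 * pi * q.1).
set C2 := cos (2 * pi * q.2); set S2 := sin (2 * pi * q.2).
move=> uniq cs2 cs1 [x0 y0 z0].
have C1n : 1 - C1 != 0 by apply/eqP => e; move: z0; rewrite e; lra.
have C2n : 1 - C2 != 0 by apply/eqP => e; move: z0; rewrite e; lra.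
have S10 : S1 = 0 by move/eqP: x0; rewrite mulf_eq0 (negbTE C2n) orbF => /eqP.
have S20 : S2 = 0 by move/eqP: y0; rewrite mulf_eq0 (negbTE C1n) orbF => /eqP.
have N1 (c s : R) : 1 - c != 0 -> c ^+ 2 + s ^+ 2 = 1 -> s = 0 -> c = -1.
  move=> cn + se; rewrite se => cs; have /eqP : (1 - c) * (c + 1) = 0 by lra.
  by rewrite mulf_eq0 (negbTE cn) => /eqP; lra.
apply: uniq => //; [exact: N1 C1n cs1 S10 | exact: N1 C2n cs2 S20].
Qed.

Lemma PI_ref_derive v :
  is_derive ((1 / 2, 1 / 2) : R * R) v (PI_ref_x \o @torus_pt R)
    (- (4 * pi) * v.1) /\
  is_derive ((1 / 2, 1 / 2) : R * R) v (PI_ref_y \o @torus_pt R)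
    (- (4 * pi) * v.2).
Proof.
have [dc1 ds1 dc2 ds2] := @derive_trig_half R v.
have d1 := is_derive_cst (1 : R) ((1 / 2, 1 / 2) : R * R) v.
split.
  apply: (is_derive_eq (is_deriveM ds1 (is_deriveB d1 dc2))).
  rewrite !fctE /= /GRing.scale /= cos_half; ring.
apply: (is_derive_eq (is_deriveM ds2 (is_deriveB d1 dc1))).
rewrite !fctE /= /GRing.scale /= cos_half; ring.
Qed.

Lemma PI_degree f : induces (@PI R) f -> has_degree f 1.
Proof.
move=> [fT fE].
have [sc1 ss1 sc2 ss2] := smooth_trig R.
have s1 := smooth_cst (1 : R).
have [cRe1 cIm1 cRe2 cIm2] := torus_coord_continuous R.
have k (c : R) (p : R[i] * R[i]) : c @[p --> p] --> c by exact: cvg_cst.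
apply: (@degree1_criterion R f PI_ref_x PI_ref_y PI_ref_z (1 / 2, 1 / 2)).
- exact: fT.
- by move=> p; exact: (cvgM (cIm1 p) (cvgB (k 1 p) (cRe2 p))).
- by move=> p; exact: (cvgM (cIm2 p) (cvgB (k 1 p) (cRe1 p))).
- move=> p; exact: (cvgB (k 2 p)
    (cvgM (cvgB (k 1 p) (cRe1 p)) (cvgB (k 1 p) (cRe2 p)))).
- exact: (smoothM ss1 (smoothB s1 sc2)).
- exact: (smoothM ss2 (smoothB s1 sc1)).
- exact: (smoothB (smooth_cst 2) (smoothM (smoothB s1 sc1) (smoothB s1 sc2))).
- move=> p s /torus_pt_surj[q /unit_squareP[q1 q2] <-] s01.
  rewrite fE // PI_bloch; have [-> -> ->] := blochK (PI_x q) (PI_y q) (PI_z q).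
  exact: PI_segment_neq0.
- by split=> /=; lra.
- exact: PI_ref_south.
- have pi0 := pi_gt0 R.
  apply: (@diagonal_jacobian_gt0 R _ _ _ (- (4 * pi)) (- (4 * pi))).
  + by move=> v; exact: (PI_ref_derive v).1.
  + by move=> v; exact: (PI_ref_derive v).2.
  + by nra.
Qed.
End ProjectionI.

Theorem corollary5p2 (R : realType) :
  (forall a : R -> R, loring_function a ->
     (exists f, induces (PL a) f) /\
     (forall f, induces (PL a) f -> has_degree f 1)) /\
  ((exists f, induces (@PI R) f) /\
   (forall f, induces (@PI R) f -> has_degree f 1)).
Proof.
split=> [a ha|]; split.
- exact: ex_PL.
- exact: PL_degree.
- exact: ex_PI.
- exact: PI_degree.
Qed.
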